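(* Each of the following categories has a stable independence notion: (1) abelian groups with monomorphisms; abelian groups with pure monomorphisms; (2) torsion-free abelian groups with pure monomorphisms; reduced torsion-free abelian groups with pure monomorphisms; (3) for any prime $p$, abelian $p$-groups with monomorphisms; abelian $p$-groups with pure monomorphisms; (4) torsion abelian groups with monomorphisms; torsion abelian groups with pure monomorphisms; (5) divisible abelian groups with monomorphisms.
   Context: An independence notion on a category $\mathcal{K}$ is a class of commutative squares $A\to B\to D$, $A\to C\to D$ (called independent) such that for any such square with a morphism $D\to E$, the square on $A,B,C,D$ is independent iff the square on $A,B,C,E$ is. It is weakly stable if it satisfies Symmetry (closed under swapping the roles of $B$ and $C$), Transitivity (closed under horizontal and vertical composition), Existence (every span $B\leftarrow A\to C$ completes to an independent square), and Uniqueness (any two independent completions $B\to D_1\leftarrow C$, $B\to D_2\leftarrow C$ admit $E$ and maps $D_1\to E$, $D_2\to E$ making the composites from $B$ agree and those from $C$ agree). $\mathcal{K}_\downarrow$ is the subcategory of $\mathcal{K}^2$ with all morphisms of $\mathcal{K}$ as objects and independent squares as morphisms. A stable independence notion is a weakly stable one for which $\mathcal{K}_\downarrow$ is an accessible category. *)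

(* Defs.v *)
From HB Require Import structures.
From mathcomp Require Import all_boot all_algebra all_classical.

Set Implicit Arguments.
Unset Strict Implicit.
Unset Printing Implicit Defensive.

Import GRing.Theory.
Local Open Scope classical_set_scope.
Local Open Scope card_scope.
Local Open Scope ring_scope.

(* A "set" in the sense of category theory is a type in the universe of the
   carriers of abelian groups.  Using exactly this universe matters: with
   larger index types the colimits below would not exist, and with smaller ones
   not every group would be a colimit of a small diagram of presentables. *)
Notation small := Type@{Algebra.Zmodule.axioms_.u0}.

Record category := Category {
  obj :> Type;
  hom : obj -> obj -> small;
  idm : forall A, hom A A;
  cmp : forall A B C, hom B C -> hom A B -> hom A C;
  cmp1m : forall A B (f : hom A B), cmp (idm B) f = f;
  cmpm1 : forall A B (f : hom A B), cmp f (idm A) = f;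
  cmpA : forall A B C D (h : hom C D) (g : hom B C) (f : hom A B),
    cmp h (cmp g f) = cmp (cmp h g) f }.

Declare Scope cat_scope.
Notation "g ∘ f" := (cmp g f) (at level 40, left associativity) : cat_scope.
Local Open Scope cat_scope.

Record functor (C D : category) := Functor {
  fobj :> C -> D;
  fmap : forall A B : C, hom A B -> hom (fobj A) (fobj B);
  fmap1 : forall A, fmap (idm A) = idm (fobj A);
  fmapM : forall A B E (g : hom B E) (f : hom A B),
    fmap (g ∘ f) = fmap g ∘ fmap f }.

Definition type_cat : category :=
  @Category small (fun A B => A -> B) (fun A x => x)
    (fun A B C g f x => g (f x))
    (fun A B f => erefl) (fun A B f => erefl) (fun A B C D h g f => erefl).

Definition hom_functor (K : category) (X : K) : functor K type_cat :=
  @Functor K type_cat (fun A => hom X A) (fun A B f x => f ∘ x)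
    (fun A => funext (fun x => cmp1m x))
    (fun A B E g f => funext (fun x => esym (cmpA g f x))).

Record poset := Poset {
  pt :> small;
  ple : pt -> pt -> Prop;
  ple_refl : forall i, ple i i;
  ple_trans : forall i j k, ple i j -> ple j k -> ple i k;
  ple_anti : forall i j, ple i j -> ple j i -> i = j }.

Record diagram (P : poset) (K : category) := Diagram {
  dobj :> P -> K;
  dmap : forall i j, ple i j -> hom (dobj i) (dobj j);
  dmap1 : forall i (ii : ple i i), dmap ii = idm (dobj i);
  dmapM : forall i j k (ij : ple i j) (jk : ple j k) (ik : ple i k),
    dmap ik = dmap jk ∘ dmap ij }.

Record cocone (P : poset) (K : category) (D : diagram P K) := Cocone {
  vertex : K;
  leg : forall i, hom (D i) vertex;
  leg_nat : forall i j (ij : ple i j), leg j ∘ dmap D ij = leg i }.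

Definition is_colimit (P : poset) (K : category) (D : diagram P K)
    (c : cocone D) : Prop :=
  forall c' : cocone D, exists! u : hom (vertex c) (vertex c'),
    forall i, u ∘ leg c i = leg c' i.

Program Definition map_diagram (P : poset) (C K : category) (F : functor C K)
    (D : diagram P C) : diagram P K :=
  @Diagram P K (fun i => F (D i)) (fun i j ij => fmap F (dmap D ij)) _ _.
Next Obligation. by move=> P C K F D i ii /=; rewrite dmap1 fmap1. Qed.
Next Obligation.
by move=> P C K F D i j k ij jk ik /=; rewrite (dmapM D ij jk ik) fmapM.
Qed.

Program Definition map_cocone (P : poset) (C K : category) (F : functor C K)
    (D : diagram P C) (c : cocone D) : cocone (map_diagram F D) :=
  @Cocone P K (map_diagram F D) (F (vertex c)) (fun i => fmap F (leg c i)) _.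
Next Obligation.
by move=> P C K F D c i j ij; rewrite /= -fmapM leg_nat.
Qed.

Definition card_lt T U (A : set T) (B : set U) : bool :=
  (A #<= B) && ~~ (B #<= A).

(* A cardinal is represented by a type of that cardinality. *)
Definition regular (l : small) : Prop :=
  infinite_set [set: l] /\
  forall (I : small) (X : I -> small),
    card_lt [set: I] [set: l] ->
    (forall i, card_lt [set: X i] [set: l]) ->
    card_lt [set: {i : I & X i}] [set: l].

Definition directed (l : small) (P : poset) : Prop :=
  forall S : set P, card_lt S [set: l] ->
    exists u : P, forall x, S x -> ple x u.

Definition presentable (l : small) (K : category) (X : K) : Prop :=
  forall (P : poset) (D : diagram P K) (c : cocone D),
    directed l P -> is_colimit c -> is_colimit (map_cocone (hom_functor X) c).

Definition has_directed_colimits (l : small) (K : category) : Prop :=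
  forall (P : poset) (D : diagram P K), directed l P ->
    exists c : cocone D, is_colimit c.

Definition accessible_at (l : small) (K : category) : Prop :=
  has_directed_colimits l K /\
  exists (J : small) (G : J -> K), (forall j, presentable l (G j)) /\
    forall X : K, exists (P : poset) (D : diagram P K) (c : cocone D),
      [/\ directed l P, forall i, exists j, D i = G j,
          is_colimit c & vertex c = X].

Definition accessible (K : category) : Prop :=
  exists l : small, regular l /\ accessible_at l K.

(* [indep f g h k] is about the square
        C --k--> D
        ^        ^
       g|        |h
        A --f--> B    *)
Record independence (K : category) := Independence {
  indep : forall A B C D : K,
    hom A B -> hom A C -> hom B D -> hom C D -> Prop;
  indep_comm : forall A B C D (f : hom A B) (g : hom A C)
    (h : hom B D) (k : hom C D), indep f g h k -> h ∘ f = k ∘ g;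
  indep_extend : forall A B C D E (f : hom A B) (g : hom A C)
    (h : hom B D) (k : hom C D) (e : hom D E), h ∘ f = k ∘ g ->
    (indep f g h k <-> indep f g (e ∘ h) (e ∘ k)) }.

Record weakly_stable (K : category) (I : independence K) : Prop := WeaklyStable {
  ws_sym : forall (A B C D : K) (f : hom A B) (g : hom A C)
    (h : hom B D) (k : hom C D), indep I f g h k -> indep I g f k h;
  ws_htrans : forall (A B B' C D D' : K) (f : hom A B) (f' : hom B B')
    (g : hom A C) (h : hom B D) (h' : hom B' D') (k : hom C D) (k' : hom D D'),
    indep I f g h k -> indep I f' h h' k' ->
    indep I (f' ∘ f) g h' (k' ∘ k);
  ws_vtrans : forall (A B C C' D D' : K) (f : hom A B) (g : hom A C)
    (g' : hom C C') (h : hom B D) (h' : hom D D') (k : hom C D) (k' : hom C' D'),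
    indep I f g h k -> indep I k g' h' k' ->
    indep I f (g' ∘ g) (h' ∘ h) k';
  ws_exist : forall (A B C : K) (f : hom A B) (g : hom A C),
    exists (D : K) (h : hom B D) (k : hom C D), indep I f g h k;
  ws_uniq : forall (A B C D1 D2 : K) (f : hom A B) (g : hom A C)
    (h1 : hom B D1) (k1 : hom C D1) (h2 : hom B D2) (k2 : hom C D2),
    indep I f g h1 k1 -> indep I f g h2 k2 ->
    exists (E : K) (e1 : hom D1 E) (e2 : hom D2 E),
      e1 ∘ h1 = e2 ∘ h2 /\ e1 ∘ k1 = e2 ∘ k2 }.

Section DownCat.
Variables (K : category) (I : independence K) (H : weakly_stable I).

Record arrow := Arrow { dom : K; cod : K; arr : hom dom cod }.

Record square (a b : arrow) : small := Square {
  sq_dom : hom (dom a) (dom b);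
  sq_cod : hom (cod a) (cod b);
  sq_indep : indep I (arr a) sq_dom sq_cod (arr b) }.

Lemma square_eq a b (s t : square a b) :
  sq_dom s = sq_dom t -> sq_cod s = sq_cod t -> s = t.
Proof.
case: s t => u v i [u' v' i'] /= eu ev; case: _ / eu i' => i'.
by case: _ / ev i' => i'; rewrite (Prop_irrelevance i i').
Qed.

Lemma indep_id (a : arrow) : indep I (arr a) (idm (dom a)) (idm (cod a)) (arr a).
Proof.
have [D [h [k i]]] := ws_exist H (arr a) (idm (dom a)).
have e := indep_comm i; rewrite cmpm1 in e.
apply/(indep_extend I h); first by rewrite cmpm1 cmp1m.
by rewrite cmpm1 e.
Qed.

Definition square_id a : square a a := Square (indep_id a).

Definition square_comp a b c (t : square b c) (s : square a b) : square a c :=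
  Square (ws_vtrans H (sq_indep s) (sq_indep t)).

Definition down_cat : category.
Proof.
refine (@Category arrow square square_id square_comp _ _ _) => *;
  apply: square_eq => /=; by rewrite ?cmp1m ?cmpm1 ?cmpA.
Defined.
End DownCat.

Definition has_stable_independence (K : category) : Prop :=
  exists (I : independence K) (H : weakly_stable I), accessible (down_cat H).

Record mor_class := MorClass {
  in_mor :> forall A B : zmodType, {additive A -> B} -> Prop;
  in_mor_id : forall A : zmodType, in_mor (idfun : {additive A -> A});
  in_mor_comp : forall (A B C : zmodType) (g : {additive B -> C})
    (f : {additive A -> B}),
    in_mor g -> in_mor f -> in_mor (g \o f : {additive A -> C}) }.

Lemma additive_eq (A B : zmodType) (f g : {additive A -> B}) : f =1 g -> f = g.
Proof.
case: f g => f [[df]] [g [[dg]]] /= /funext fg; case: _ / fg dg => dg.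
by rewrite (Prop_irrelevance df dg).
Qed.

Section AbCat.
Variables (M : mor_class) (P : zmodType -> Prop).

Definition ab_obj := {A : zmodType | P A}.

Definition ab_hom (A B : ab_obj) : small :=
  {f : {additive (sval A) -> (sval B)} | M _ _ f}.

Lemma ab_hom_eq (A B : ab_obj) (f g : ab_hom A B) :
  sval f =1 sval g -> f = g.
Proof.
by case: f g => f fM [g gM] /= fg; apply: eq_exist; apply: additive_eq.
Qed.

Definition ab_id (A : ab_obj) : ab_hom A A := exist _ _ (in_mor_id M (sval A)).

Definition ab_comp (A B C : ab_obj) (g : ab_hom B C) (f : ab_hom A B) :
    ab_hom A C :=
  exist _ _ (in_mor_comp (proj2_sig g) (proj2_sig f)).

Definition ab_cat : category.
Proof.
refine (@Category ab_obj ab_hom ab_id ab_comp _ _ _) => *;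
  by apply: ab_hom_eq.
Defined.
End AbCat.

(* The image of f is a pure subgroup of B. *)
Definition pure (A B : zmodType) (f : {additive A -> B}) : Prop :=
  forall (n : nat) (a : A), (exists b : B, b *+ n = f a) ->
    exists a' : A, f a' *+ n = f a.

(* Injective homomorphisms, i.e. the monomorphisms of the category of all
   abelian groups; the categorical monomorphisms of the full subcategory of
   divisible groups need not be injective. *)
Program Definition mono : mor_class :=
  @MorClass (fun A B f => injective f) _ _.
Next Obligation. by move=> A x y. Qed.
Next Obligation. by move=> A B C g f gi fi; apply: inj_comp. Qed.

Program Definition pure_mono : mor_class :=
  @MorClass (fun A B f => injective f /\ pure f) _ _.
Next Obligation. by move=> A; split=> [x y //|n a [b <-]]; exists b. Qed.
Next Obligation.
move=> A B C g f [gi gp] [fi fp]; split; first exact: inj_comp.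
move=> n a [c /= /(fun e => ex_intro (fun c => c *+ n = _) c e) /gp[b]].
rewrite -raddfMn => /gi bE; have [|a' a'E] := fp n a; first by exists b.
by exists a'; rewrite /= -raddfMn a'E.
Qed.

Definition any_group (A : zmodType) : Prop := True.

Definition torsion_free (A : zmodType) : Prop :=
  forall (n : nat) (x : A), (0 < n)%N -> x *+ n = 0 -> x = 0.

Definition torsion (A : zmodType) : Prop :=
  forall x : A, exists2 n : nat, (0 < n)%N & x *+ n = 0.

Definition p_group (p : nat) (A : zmodType) : Prop :=
  forall x : A, exists n : nat, x *+ (p ^ n)%N = 0.

Definition divisible_in (A : zmodType) (S : {pred A}) : Prop :=
  forall (n : nat) (x : A), (0 < n)%N -> x \in S ->
    exists2 y : A, y \in S & y *+ n = x.

Definition divisible (A : zmodType) : Prop := divisible_in (@predT A).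

(* The only divisible subgroup is the zero subgroup. *)
Definition reduced (A : zmodType) : Prop :=
  forall S : {pred A}, GRing.zmod_closed S -> divisible_in S ->
    forall x, x \in S -> x = 0.

(* Main.v *)
(* All nine categories are handled at once through a set N of natural numbers:
   [npure N f] asks that f : A -> B induce injections A/nA -> B/nB for n in N.
   A commutative square A -> B -> D, A -> C -> D is declared independent when
   the induced map from the pushout of B and C over A to D is [npure N]; weak
   stability is then formal.  The case N = positive integers is needed for
   reduced torsion-free groups, whose pushouts may fail to be reduced: there
   the amalgam is the quotient of the pushout by its divisible part.

   Accessibility holds at aleph_1.  Directed colimits in K_down are computed on
   the underlying groups.  For f : A -> B, the countable subgroups S of B that
   are closed under countably many choices of roots form an aleph_1-directed
   family, the squares from f^-1 S -> S to A -> B are independent, and arrows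
   with countable codomain are aleph_1-presentable since a map out of them
   factors through a stage as soon as countably many values do. *)
From HB Require Import structures.
From mathcomp Require Import all_boot all_algebra all_classical wochoice.
Require Import Defs.

Set Implicit Arguments.
Unset Strict Implicit.
Unset Printing Implicit Defensive.

Import GRing.Theory.
Local Open Scope classical_set_scope.
Local Open Scope card_scope.
Local Open Scope quotient_scope.
Local Open Scope ring_scope.
Local Open Scope cat_scope.

(** * Constructions of abelian groups *)

Lemma additive_of_fun (A B : zmodType) (f : A -> B) :
  {morph f : x y / x - y} -> exists g : {additive A -> B}, g =1 f.
Proof.
move=> fB; pose m := GRing.isZmodMorphism.Build A B f fB.
by exists (HB.pack_for {additive A -> B} f m).
Qed.

(** A total relation closed under differences is single-valued as soon as it is so at 0. This yields
    maps out of quotients and colimits without choosing representatives. *)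
Lemma additive_of_rel (A B : zmodType) (R : A -> B -> Prop) :
  (forall x, exists y, R x y) -> (forall y, R 0 y -> y = 0) ->
  (forall x x' y y', R x y -> R x' y' -> R (x - x') (y - y')) ->
  exists f : {additive A -> B}, forall x y, R x y <-> f x = y.
Proof.
move=> /choice[f fR] R0 RB.
have Rf x y : R x y -> f x = y.
  move=> xy; apply/eqP; rewrite -subr_eq0; apply/eqP/R0.
  by rewrite -(subrr x); apply: RB.
have [x y|g gf] := @additive_of_fun A B f; first by apply/Rf/RB.
by exists g => x y; rewrite gf; split=> [/Rf|<-].
Qed.

Lemma additive_lift (A B X : zmodType) (i : {additive A -> B})
    (f : {additive X -> B}) :
  injective i -> (forall x, exists a, i a = f x) ->
  exists g : {additive X -> A}, forall x, i (g x) = f x.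
Proof.
move=> inj fi.
have [//|y|x x' y y' e e'|g gP] := @additive_of_rel X A (fun x y => i y = f x).
- by rewrite raddf0 -(raddf0 i) => /inj.
- by rewrite !raddfB e e'.
by exists g => x; apply/gP.
Qed.

Section ClosedSet.
Variables (A : zmodType) (S : set A).
Hypotheses (S0 : S 0) (SB : forall x y, S x -> S y -> S (x - y)).

Let closed : GRing.zmod_closed (mem S).
Proof. by split=> [|x y]; rewrite !inE //; apply: SB. Qed.

(** The proof of closure is an argument so that the instance attached to the constant [closed_pred]
    can recover it. *)
Definition closed_pred of GRing.zmod_closed (mem S) : {pred A} := mem S.
HB.instance Definition _ (c : GRing.zmod_closed (mem S)) :=
  GRing.isZmodClosed.Build A (closed_pred c) c.

Definition subgroup := {x : A | x \in closed_pred closed}.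
HB.instance Definition _ := SubChoice.on subgroup.
HB.instance Definition _ := [SubChoice_isSubZmodule of subgroup by <:].

Lemma subgroup_exists : exists (B : zmodType) (i : {additive B -> A}),
  injective i /\ forall x, S x <-> exists b, i b = x.
Proof.
exists subgroup, (val : {additive subgroup -> A}); split; first exact: val_inj.
move=> x; split=> [Sx|[[y Sy] <-]]; last exact: set_mem Sy.
have Sx' : x \in closed_pred closed by rewrite inE.
by exists (Sub x Sx').
Qed.

Lemma quotient_exists : exists (B : zmodType) (q : {additive A -> B}),
  (forall y, exists x, q x = y) /\ forall x, q x = 0 <-> S x.
Proof.
exists (Quotient.quot (closed_pred closed)),
  (\pi_(Quotient.quot (closed_pred closed)) : {additive _ -> _}).
split=> [y|x]; first by exists (repr y); rewrite /= reprK.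
rewrite -(raddf0 (\pi_(Quotient.quot (closed_pred closed)) : {additive _ -> _})).
split=> [/eqP|Sx]; last apply/eqP.
  by rewrite -Quotient.idealrBE subr0 inE.
by rewrite -Quotient.idealrBE subr0 inE.
Qed.
End ClosedSet.

Definition dprod (I : Type) (A : I -> zmodType) : Type := forall i, A i.

Section DependentProduct.
Variables (I : Type) (A : I -> zmodType).
Implicit Types x y z : dprod A.

HB.instance Definition _ := gen_eqMixin (dprod A).
HB.instance Definition _ := gen_choiceMixin (dprod A).

Definition dprod0 : dprod A := fun=> 0.
Definition dprodN x : dprod A := fun i => - x i.
Definition dprodD x y : dprod A := fun i => x i + y i.

Lemma dprodDA : associative dprodD.
Proof. by move=> x y z; apply: functional_extensionality_dep => i; apply: addrA. Qed.
Lemma dprodDC : commutative dprodD.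
Proof. by move=> x y; apply: functional_extensionality_dep => i; apply: addrC. Qed.
Lemma dprod0D : left_id dprod0 dprodD.
Proof. by move=> x; apply: functional_extensionality_dep => i; apply: add0r. Qed.
Lemma dprodND : left_inverse dprod0 dprodN dprodD.
Proof. by move=> x; apply: functional_extensionality_dep => i; apply: addNr. Qed.

HB.instance Definition _ :=
  GRing.isZmodule.Build (dprod A) dprodDA dprodDC dprod0D dprodND.

Lemma dprodB x y i : (x - y) i = x i - y i. Proof. by []. Qed.
End DependentProduct.

(* The colimit is realised inside the product of the groups modulo the
   eventually vanishing families, as the union of the images of the groups. *)
Lemma group_colimit (P : poset) (A : P -> zmodType)
    (t : forall i j, ple i j -> {additive A i -> A j}) :
  (forall i j, exists k : P, ple i k /\ ple j k) -> P ->
  (forall i (ii : ple i i) x, t i i ii x = x) ->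
  (forall i j k (ij : ple i j) (jk : ple j k) (ik : ple i k) x,
     t i k ik x = t j k jk (t i j ij x)) ->
  (forall i j (ij : ple i j), injective (t i j ij)) ->
  exists (L : zmodType) (l : forall i, {additive A i -> L}),
    [/\ forall i, injective (l i),
        forall i j (ij : ple i j) x, l j (t i j ij x) = l i x
      & forall y, exists i x, y = l i x].
Proof.
move=> dir i0 t1 tM tI.
pose Z : set (dprod A) := [set x | exists i, forall j, ple i j -> x j = 0].
have Z0 : Z 0 by exists i0.
have ZB x y : Z x -> Z y -> Z (x - y).
  move=> [i xi] [j yj]; have [k [ik jk]] := dir i j.
  exists k => m km; rewrite dprodB xi ?yj ?subrr //;
  exact: ple_trans km.
have [U [q [qs qZ]]] := quotient_exists Z0 ZB.
(* The value 0 off the cone above i is an arbitrary choice: modulo [Z] only the values on some cone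
   matter. *)
pose ext i (a : A i) : dprod A :=
  fun j => if pselect (ple i j) is left ij then t i j ij a else 0.
have extE i j (ij : ple i j) a : ext i a j = t i j ij a.
  by rewrite /ext; case: pselect => // ij'; rewrite (Prop_irrelevance ij ij').
have extB i : {morph ext i : a b / a - b}.
  move=> a b; apply: functional_extensionality_dep => j; rewrite dprodB /ext.
  by case: pselect => [ij|_]; rewrite ?raddfB ?subrr.
have /all_sig[e eE] i := cid (additive_of_fun (@extB i)).
pose l0 i : {additive A i -> U} := q \o e i.
have l0t i j (ij : ple i j) x : l0 j (t i j ij x) = l0 i x.
  apply/eqP; rewrite -subr_eq0 /= -raddfB; apply/eqP/qZ.
  exists j => k jk; rewrite dprodB !eE (extE j k jk) (extE i k (ple_trans ij jk)).
  by rewrite -(tM i j k ij jk (ple_trans ij jk)) subrr.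
have l0I i : injective (l0 i).
  apply: raddf_inj => a /qZ[j aj]; have [k [ik jk]] := dir i j.
  by have := aj k jk; rewrite eE (extE i k ik) -(raddf0 (t i k ik)) => /tI.
pose S : set U := [set y | exists i x, y = l0 i x].
have S0 : S 0 by exists i0, 0; rewrite raddf0.
have SB x y : S x -> S y -> S (x - y).
  move=> [i [a ->]] [j [b ->]]; have [k [ik jk]] := dir i j.
  by exists k, (t i k ik a - t j k jk b); rewrite raddfB !l0t.
have [L [v [vI vS]]] := subgroup_exists S0 SB.
have lP i : exists l : {additive A i -> L}, forall x, v (l x) = l0 i x.
  by apply: additive_lift => // x; apply/vS; exists i, x.
have /all_sig[l lE] i := cid (lP i).
exists L, l; split=> [i x y xy|i j ij x|y].
- by apply: (l0I i); rewrite -!lE xy.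
- by apply: vI; rewrite !lE l0t.
- have [i [x yE]] : S (v y) by apply/vS; exists y.
  by exists i, x; apply: vI; rewrite lE.
Qed.

(** The quotient of B × C by the pairs (f a, - g a). Generation by the two images and the
    description of the kernel are all that later proofs use of the pushout. *)
Lemma group_pushout (A B C : zmodType) (f : {additive A -> B})
    (g : {additive A -> C}) :
  exists (Q : zmodType) (h : {additive B -> Q}) (k : {additive C -> Q}),
    (forall y, exists b c, y = h b + k c) /\
    forall b c, h b + k c = 0 <-> exists a, b = f a /\ c = - g a.
Proof.
pose S : set (B * C)%type := [set x | exists a, x.1 = f a /\ x.2 = - g a].
have S0 : S 0 by exists 0; rewrite /= !raddf0.
have SB x y : S x -> S y -> S (x - y).
  move=> [a [fa ga]] [b [fb gb]]; exists (a - b).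
  by rewrite !raddfB /= fa fb ga gb !opprK addrC.
have [Q [q [qs qS]]] := quotient_exists S0 SB.
have hB : {morph (fun b : B => q (b, 0)) : x y / x - y}.
  by move=> x y; rewrite -raddfB; congr (q (_, _)); rewrite subr0.
have kB : {morph (fun c : C => q (0, c)) : x y / x - y}.
  by move=> x y; rewrite -raddfB; congr (q (_, _)); rewrite subr0.
have [h hE] := additive_of_fun hB; have [k kE] := additive_of_fun kB.
have hk b c : h b + k c = q (b, c).
  by rewrite hE kE -raddfD; congr (q (_, _)); rewrite ?addr0 ?add0r.
exists Q, h, k; split=> [y|b c]; last by rewrite hk qS.
by have [[b c] <-] := qs y; exists b, c; rewrite hk.
Qed.

(** * The first uncountable cardinal *)

Lemma uncountable_cantor : ~ countable [set: nat -> bool].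
Proof.
move=> /countable_injP[f fI].
pose d n := ~~ `[< exists2 x, f x = n & x n >].
have := erefl (d (f d)); rewrite {1}/d; case: asboolP => [[x fx xf]|nx].
  have xd : x = d by apply: fI fx; rewrite ?inE.
  by move: xf; rewrite xd => ->.
by move=> /esym dd; case: nx; exists d.
Qed.

(** The type [l] is an uncountable well-ordered set whose proper initial segments are all countable.
    Such a set injects into every uncountable set, so the sets strictly smaller than it are exactly
    the countable ones. *)
Lemma aleph1_exists : exists l : small,
  forall T (A : set T), card_lt A [set: l] <-> countable A.
Proof.
have [R woR] := well_ordering_principle (nat -> bool).
pose seg x := [set y | R y x /\ y <> x].
have Rmin (S : set (nat -> bool)) :
    S !=set0 -> exists2 x, S x & forall y, S y -> R x y.
  move=> [x Sx]; have [|z [[zS lb] _]] := woR (mem S).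
    by exists x; rewrite inE.
  by exists z => [|y Sy]; [exact: set_mem zS|apply: lb; rewrite inE].
have Rtot x y : x <> y -> seg y x \/ seg x y.
  have [|z [->|->] zm] := Rmin [set x; y]; first by exists x; left.
    by move=> xy; left; split=> //; apply: zm; right.
  by move=> xy; right; split; [apply: zm; left|move/esym].
(* Antisymmetry: x and y would both be least in the pair they form, and least elements are
   unique. *)
have segirr x y : R x y -> R y x -> x = y.
  move=> xy yx; have [|z [_ zu]] := woR (mem [set x; y]).
    by exists x; rewrite inE; left.
  have Rxx u : R u u.
    by have [|v -> vm] := Rmin [set u]; [exists u|exact: vm].
  have mx : x \in [set x; y] by rewrite inE; left.
  have my : y \in [set x; y] by rewrite inE; right.
  rewrite -(zu x) ?(zu y) //; split=> // u; rewrite inE /= => -[] ->;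
  by rewrite ?xy ?yx ?Rxx.
have [A [Anc Aseg]] : exists A : set (nat -> bool),
    ~ countable A /\ forall x, A x -> countable (seg x `&` A).
  (* If some initial segment is uncountable, take the segment of the least such point; otherwise
     take the whole order. *)
  have [ex|nex] := pselect (exists x, ~ countable (seg x)).
    have [//|x xnc xm] := Rmin [set x | ~ countable (seg x)].
    exists (seg x); split=> // y [yx ynx]; apply: contrapT => nc.
    apply: ynx; apply: segirr => //; apply: xm => /= cy; apply: nc.
    by apply: sub_countable cy; apply: subset_card_le => z [].
  exists setT; split=> [|x _]; first exact: uncountable_cantor.
  rewrite setIT; apply: contrapT => nc; by case: nex; exists x.
have wf : well_founded (fun x y => seg y x).
  move=> x; apply: contrapT => nx.
  have [|y ny ym] := Rmin [set y | ~ Acc (fun x y => seg y x) y]; first by exists x.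
  apply: ny; split=> z [zy znz]; apply: contrapT => nz.
  by apply/znz/segirr => //; apply: ym.
have emb T (B : set T) : ~ countable B -> [set: A] #<= B.
  elim/Pchoice: T => T in B *; move=> Bnc.
  have [b0 _] : B !=set0.
    by apply/set0P/negP => /eqP B0; apply: Bnc; rewrite B0; exact: countable0.
  (* Transfinite recursion: the value at x is a point of [B] distinct from all values at earlier
     points of [A]. For x in [A] the default case does not occur, since the earlier values form a
     countable set and [B] is uncountable. *)
  pose F x (h : forall y, seg x y -> T) : T :=
    xget b0 [set b | B b /\ forall y (yx : seg x y), A y -> h y yx <> b].
  pose h := Fix wf (fun=> T) F.
  have hE x : h x = xget b0 [set b | B b /\ forall y, seg x y -> A y -> h y <> b].
    rewrite /h Fix_eq // => y u v uv; congr xget; apply/seteqP; split=> b [Bb bP].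
      by split=> // z zy; rewrite -uv; apply: bP.
    by split=> // z zy; rewrite uv; apply: bP.
  have hP x : A x -> B (h x) /\ forall y, seg x y -> A y -> h y <> h x.
    move=> Ax; rewrite (hE x); case: xgetP => [b _ //|no].
    case: Bnc; apply: (@sub_countable _ _ _ (h @` (seg x `&` A))).
      apply: subset_card_le => b Bb; apply: contrapT => nb; apply: (no b).
      by split=> // y xy Ay hy; apply: nb; exists y.
    exact: sub_countable (card_image_le _ _) (Aseg x Ax).
  rewrite (card_le_eql (card_setT A)).
  have hI : {in A &, injective h}.
    move=> x y /set_mem Ax /set_mem Ay hxy; apply: contrapT => /Rtot[s|s].
      by have [_ /(_ x s Ax)] := hP y Ay.
    by have [_ /(_ y s Ay)] := hP x Ax; rewrite hxy.
  rewrite -(card_le_eql (inj_card_eq hI)); apply: subset_card_le => _ [x Ax <-].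
  exact: (hP x Ax).1.
exists A => T B; rewrite /card_lt; split.
  by move=> /andP[_ /negP nAB]; apply: contrapT => /emb.
move=> cB; apply/andP; split; last first.
  apply/negP => AB; apply: Anc; rewrite -(eq_countable (card_setT A)).
  exact: sub_countable AB cB.
apply: card_le_trans cB _; apply/infiniteP => fA; apply: Anc.
rewrite -(eq_countable (card_setT A)); exact: finite_set_countable.
Qed.

Lemma regular_of_countable (l : small) :
  (forall T (A : set T), card_lt A [set: l] <-> countable A) -> regular l.
Proof.
move=> lP; split=> [fl|I X /lP cI cX].
  by have /lP := finite_set_countable fl; rewrite /card_lt card_lexx andbF.
apply/lP; suff -> : [set: {i : I & X i}] =
    \bigcup_i (fun x : X i => existT X i x) @` [set: X i].
  apply: bigcup_countable => // i _.
  by apply: sub_countable (card_image_le _ _) _; apply/lP.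
by apply/seteqP; split=> // -[i x] _; exists i => //; exists x.
Qed.

Lemma countable_range T (A : set T) (x0 : T) : A x0 ->
  countable A <-> exists e : nat -> T, forall x, A x <-> exists n, e n = x.
Proof.
elim/Pchoice: T => T in A x0 *; move=> Ax0; split=> [/countable_injP[f fI]|[e eA]].
  exists (fun n => xget x0 [set x | A x /\ f x = n]) => x; split=> [Ax|[n <-]].
    exists (f x); case: xgetP => [y _ [Ay fy]|/(_ x)[]//].
    by apply: fI; rewrite ?inE.
  by case: xgetP => [y _ []|].
have -> : A = range e.
  apply/seteqP; split=> x; first by move=> /eA[n <-]; exists n.
  by move=> [n _ <-]; apply/eA; exists n.
exact: sub_countable (card_image_le _ _) (countableP _).
Qed.

(** * Stable independence for a class of groups *)

(** The graph of the map consists of the pairs (l i x, m i x). Injectivity of the legs makes it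
    single-valued at 0; directedness makes it closed under differences. *)
Lemma group_colimit_map (P : poset) (A : P -> zmodType) (L X : zmodType)
    (t : forall i j, ple i j -> {additive A i -> A j})
    (l : forall i, {additive A i -> L}) (m : forall i, {additive A i -> X}) :
  (forall i j, exists k : P, ple i k /\ ple j k) ->
  (forall i j (ij : ple i j) x, l j (t i j ij x) = l i x) ->
  (forall i j (ij : ple i j) x, m j (t i j ij x) = m i x) ->
  (forall i, injective (l i)) -> (forall y, exists i x, l i x = y) ->
  exists u : {additive L -> X}, forall i x, u (l i x) = m i x.
Proof.
move=> dir lt mt lI ls.
have [y|y [i [x [lx <-]]]|y y' z z' [i [x [<- <-]]] [j [x' [<- <-]]]|u uP] :=
  @additive_of_rel L X (fun y z => exists i x, l i x = y /\ m i x = z).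
- by have [i [x <-]] := ls y; exists (m i x), i, x.
- by rewrite (_ : x = 0) ?raddf0 //; apply: (lI i); rewrite lx raddf0.
- have [k [ik jk]] := dir i j; exists k, (t i k ik x - t j k jk x').
  by rewrite !raddfB !lt !mt.
by exists u => i x; apply/uP; exists i, x.
Qed.

(* [npure N f] says that f induces injections A/nA -> B/nB for n in N.  With
   N = {0} this is injectivity, with N = nat it is injectivity together with
   purity, and with N the positive integers it is purity modulo a kernel which
   becomes divisible when B is torsion-free. *)
Definition npure (N : set nat) (A B : zmodType) (f : {additive A -> B}) : Prop :=
  forall n a b, N n -> f a = b *+ n -> exists a', a = a' *+ n.

(* For a commutative square, this is [npure N] of the map from the pushout. *)
Definition nindep (N : set nat) (A B C D : zmodType) (f : {additive A -> B})
    (g : {additive A -> C}) (h : {additive B -> D}) (k : {additive C -> D}) : Prop :=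
  (forall a, h (f a) = k (g a)) /\
  forall n b c d, N n -> h b + k c = d *+ n ->
    exists b' c' a, b = b' *+ n + f a /\ c = c' *+ n - g a.

Section Independence.
Variable N : set nat.

Lemma nindep_sym (A B C D : zmodType) (f : {additive A -> B})
    (g : {additive A -> C}) (h : {additive B -> D}) (k : {additive C -> D}) :
  nindep N f g h k -> nindep N g f k h.
Proof.
move=> [e i]; split=> [a|n c b d Nn]; first by rewrite e.
rewrite addrC => /(i n _ _ _ Nn)[b' [c' [a [-> ->]]]].
by exists c', b', (- a); rewrite !raddfN opprK.
Qed.

Lemma nindep_trans (A B B' C D D' : zmodType) (f : {additive A -> B})
    (f' : {additive B -> B'}) (g : {additive A -> C}) (h : {additive B -> D})
    (h' : {additive B' -> D'}) (k : {additive C -> D}) (k' : {additive D -> D'}) :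
  nindep N f g h k -> nindep N f' h h' k' -> nindep N (f' \o f) g h' (k' \o k).
Proof.
move=> [e i] [e' i']; split=> [a|n b' c d Nn] /=; first by rewrite e' e.
move=> /(i' n _ _ _ Nn)[b1 [d1 [b [-> kc]]]].
have /(i n _ _ _ Nn)[b2 [c' [a [-> ->]]]] : h b + k c = d1 *+ n.
  by rewrite kc addrC subrK.
exists (b1 + f' b2), c', a; split=> //.
by rewrite raddfD raddfMn mulrnDl addrA.
Qed.

(** Independence passes from a composite square to its first factor: the composite gives an n-th
    root in [A], and [npure N u] brings it back to [A1]. *)
Lemma nindep_cancel (A0 A1 A B0 B1 B : zmodType) (f0 : {additive A0 -> B0})
    (f1 : {additive A1 -> B1}) (f : {additive A -> B})
    (u0 : {additive A0 -> A1}) (u : {additive A1 -> A})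
    (v0 : {additive B0 -> B1}) (v : {additive B1 -> B})
    (u1 : {additive A0 -> A}) (v1 : {additive B0 -> B}) :
  npure N u -> (forall a, f (u a) = v (f1 a)) -> (forall a, v0 (f0 a) = f1 (u0 a)) ->
  (forall a, u (u0 a) = u1 a) -> (forall b, v (v0 b) = v1 b) ->
  nindep N f0 u1 v1 f -> nindep N f0 u0 v0 f1.
Proof.
move=> up fu vf uu vv [_ i]; split=> // n b a d Nn /(congr1 v).
rewrite raddfD raddfMn -fu vv => /(i n _ _ _ Nn)[b' [a' [a0 [-> ua]]]].
have /(up n _ _ Nn)[a2 aE] : u (a + u0 a0) = a' *+ n by rewrite raddfD uu ua subrK.
by exists b', a2, a0; rewrite -aE addrK.
Qed.

(** Take c = 0 in the independence condition. This is what makes the legs of an amalgam morphisms of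
    the category. *)
Lemma nindep_pure (A B C D : zmodType) (f : {additive A -> B})
    (g : {additive A -> C}) (h : {additive B -> D}) (k : {additive C -> D}) :
  npure N g -> nindep N f g h k -> npure N h.
Proof.
move=> gp [_ i] n b d Nn hb.
have [|b' [c' [a [-> /eqP]]]] := i n b 0 d Nn; first by rewrite raddf0 addr0.
rewrite eq_sym subr_eq0 => /eqP /esym /(gp n _ _ Nn)[a' ->].
by exists (b' + f a'); rewrite raddfMn mulrnDl.
Qed.

End Independence.


(** * Countable subobjects of an arrow *)

Lemma countable_closure (T : Type) (I : countType) (op : I -> T -> T -> T)
    (i0 : I) (S0 : set T) :
  (forall x y, op i0 x y = x) -> countable S0 ->
  exists S : set T, [/\ countable S, S0 `<=` S &
    forall i x y, S x -> S y -> S (op i x y)].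
Proof.
move=> op0 cS0.
(* One round of closure, iterated over the natural numbers. The projection [op i0] makes the rounds
   increasing, so two elements always lie in a common round. *)
pose F (S : set T) := \bigcup_i (fun p => op i p.1 p.2) @` (S `*` S).
have Fsub S : S `<=` F S by move=> x Sx; exists i0 => //; exists (x, x).
have mono_iter m k : iter m F S0 `<=` iter (k + m) F S0.
  by elim: k => // k IH x /IH /Fsub.
exists (\bigcup_m iter m F S0); split.
- apply: bigcup_countable => // m _; elim: m => //= m IH.
  apply: bigcup_countable => // i _.
  by apply: sub_countable (card_image_le _ _) _; apply: countableX.
- by move=> x S0x; exists 0%N.
move=> i x y [m _ mx] [k _ ky]; exists (k + m).+1 => //; exists i => //.
exists (x, y) => //; split=> /=; first exact: mono_iter.
by rewrite addnC; apply: mono_iter.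
Qed.

(* Closure conditions making (f^-1 S, S) a small subobject of f : A -> B in the
   category of arrows and independent squares. *)
Record good (A B : zmodType) (f : {additive A -> B}) (S : set B) : Prop := Good {
  good_countable : countable S;
  good0 : S 0;
  goodB : forall x y, S x -> S y -> S (x - y);
  good_pure : forall n d, S (d *+ n) -> exists2 d', S d' & d *+ n = d' *+ n;
  good_preim_pure : forall n a, S (f (a *+ n)) ->
    exists2 a', S (f a') & a *+ n = a' *+ n;
  good_indep : forall n d a, S (d *+ n + f a) ->
    exists d' a', S d' /\ d *+ n + f a = d' *+ n + f a' }.

Lemma good_exists (A B : zmodType) (f : {additive A -> B}) (S0 : set B) :
  injective f -> countable S0 -> exists2 S, good f S & S0 `<=` S.
Proof.
move=> fI cS0.
(* With n the first index, the second index selects: the projection required by [countable_closure],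
   the difference, an n-th root, an n-th root up to the image of [f], and an n-th root inside that
   image. The default 0 belongs to the closure anyway. *)
pose op (i : nat * nat) (x y : B) := match i.2 with
  | 0 => x
  | 1 => x - y
  | 2 => xget 0 [set d | x = d *+ i.1]
  | 3 => xget 0 [set d | exists a, x = d *+ i.1 + f a]
  | _ => xget 0 [set d | x = d *+ i.1 /\ exists a, d = f a]
  end.
have c0 : countable (0 |` S0).
  rewrite -bigcup2E; apply: bigcup_countable => // -[|[|i]] _ //=; exact: countable1.
have [S [cS S0S Sop]] := @countable_closure B _ op (0, 0)%N _ (fun x y => erefl) c0.
have S0' : S 0 by apply: S0S; left.
exists S; last by move=> x ?; apply: S0S; right.
split=> // [x y Sx Sy|n d Sd|n a Sa|n d a Sda].
- exact: (Sop (0, 1)%N).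
- have := Sop (n, 2)%N _ _ Sd Sd; rewrite /op /=.
  by case: xgetP => [d' _ dd'|/(_ d)/(_ erefl)//]; exists d'.
- have := Sop (n, 4)%N _ _ Sa Sa; rewrite /op /=.
  case: xgetP => [y _ [ad' [a' ya']]|/(_ (f a)) []]; last first.
    by rewrite raddfMn; split=> //; exists a.
  by rewrite ya' => Sa'; exists a' => //; apply: fI; rewrite ad' ya' raddfMn.
- have := Sop (n, 3)%N _ _ Sda Sda; rewrite /op /=.
  case: xgetP => [d' _ [a' e]|/(_ d) []]; last by exists a.
  by exists d', a'.
Qed.

Section SmallSubobject.
Variables (N : set nat) (A B A0 B0 : zmodType).
Variables (f : {additive A -> B}) (f0 : {additive A0 -> B0}).
Variables (u : {additive A0 -> A}) (v : {additive B0 -> B}) (S : set B).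
Hypotheses (gS : good f S) (fp : npure N f).
Hypotheses (uI : injective u) (vI : injective v).
Hypothesis fu : forall a, f (u a) = v (f0 a).
Hypothesis uS : forall a, S (f a) <-> exists a0, u a0 = a.
Hypothesis vS : forall b, S b <-> exists b0, v b0 = b.

Lemma good_dom_pure : npure setT u.
Proof.
move=> n a0 a _ uan; have [|a' /uS[a1 <-]] := @good_preim_pure _ _ _ _ gS n a.
  by apply/uS; exists a0.
by rewrite -uan -raddfMn => /uI ->; exists a1.
Qed.

Lemma good_cod_pure : npure setT v.
Proof.
move=> n b0 b _ vbn; have [|b' /vS[b1 <-]] := @good_pure _ _ _ _ gS n b.
  by apply/vS; exists b0.
by rewrite -vbn -raddfMn => /vI ->; exists b1.
Qed.

(** The element v b = n d - f a lies in [S], so [good_indep] rewrites it as n d' + f a' with d' in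
    [S]. Then f a' lies in [S], so a' comes from [A0], and a + a' is divisible by n because [f] is
    npure. *)
Lemma good_nindep : nindep N f0 u v f.
Proof.
split=> [a|n b a d Nn vfa]; first by rewrite fu.
have vb : v b = d *+ n + f (- a) by rewrite -vfa raddfN addrK.
have [|d' [a' [/vS[b' <-]]]] := @good_indep _ _ _ _ gS n d (- a).
  by rewrite -vb; apply/vS; exists b.
rewrite -vb => vb'.
have fa' : f a' = v (b - b' *+ n) by rewrite raddfB raddfMn vb' addrC addKr.
have [a0 a0E] : exists a0, u a0 = a' by apply/uS; rewrite fa'; apply/vS; eexists.
have /(fp Nn)[a2 a2E] : f (a + a') = (d - v b') *+ n.
  by rewrite raddfD fa' raddfB addrA (addrC (f a)) vfa raddfMn mulrnBl.
exists b', a2, a0; split; last by rewrite a0E -a2E addrK.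
by apply: vI; rewrite raddfD raddfMn -fu a0E.
Qed.
End SmallSubobject.

(* An enumeration e of B determines f : A -> B up to isomorphism through the
   addition table and the image of f, so that countable arrows form a set. *)
Definition code (A B : zmodType) (f : {additive A -> B}) (e : nat -> B) :
    set (nat * nat * nat) * set nat :=
  ([set t | e t.1.1 + e t.1.2 = e t.2], [set k | exists a, f a = e k]).

(** The map [v] sends [e k] to [e' k], which the addition table makes well defined and injective;
    [u] is its lift through [f'], and equality of the image codes makes the lift exist and be
    onto. *)
Lemma code_iso (A B A' B' : zmodType) (f : {additive A -> B})
    (f' : {additive A' -> B'}) (e : nat -> B) (e' : nat -> B') :
  injective f -> injective f' ->
  (forall y, exists n, e n = y) -> (forall y, exists n, e' n = y) ->
  code f e = code f' e' ->
  exists (u : {additive A -> A'}) (v : {additive B -> B'}),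
    [/\ injective u, injective v, forall a', exists a, u a = a',
        forall b', exists b, v b = b' & forall a, f' (u a) = v (f a)].
Proof.
move=> fI f'I es e's /pair_equal_spec[/seteqP[eD e'D] /seteqP[ef e'f]].
have add k l m : e k + e l = e m <-> e' k + e' l = e' m.
  by split=> [/(eD (k, l, m))|/(e'D (k, l, m))].
(* In a group 0 is the only solution of x + x = x, so the addition table determines which indices
   name 0. *)
have zero k : e k = 0 <-> e' k = 0.
  have := add k k k; split=> [ek|ek].
    by apply: (addrI (e' k)); rewrite addr0; apply/add; rewrite ek addr0.
  by apply: (addrI (e k)); rewrite addr0; apply/add; rewrite ek addr0.
have [y|y [k [/zero ek <-//]]|y y' z z' [k [<- <-]] [l [<- <-]]|v vP] :=
  @additive_of_rel B B' (fun y z => exists k, e k = y /\ e' k = z).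
- by have [k <-] := es y; exists (e' k), k.
- have [m em] := es (e k - e l); exists m; split=> //.
  by apply: (addIr (e' l)); rewrite subrK; apply/add; rewrite em subrK.
have ve k : v (e k) = e' k by apply/vP; exists k.
have vI : injective v.
  by apply: raddf_inj => y; have [k <-] := es y; rewrite ve => /zero.
have [a|u uP] := @additive_lift A' B' A f' (v \o f) f'I.
  have [k ek] := es (f a); have [|a' a'E] := ef k; first by exists a.
  by exists a'; rewrite /= -ek ve.
exists u, v; split=> // [a1 a2 ua|a'|b'].
- by have := congr1 f' ua; rewrite !uP => /vI/fI.
- have [k ek] := e's (f' a'); have [|a aE] := e'f k; first by exists a'.
  by exists a; apply: f'I; rewrite uP /= aE ve.
- by have [k <-] := e's b'; exists (e k).
Qed.

(** * Weak stability for an abstract class of groups *)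

Section StableClass.
Variables (M : mor_class) (C : zmodType -> Prop) (N : set nat).

Hypothesis mor_npure : forall (A B : zmodType) (f : {additive A -> B}),
  C A -> C B -> M A B f <-> npure N f.

Hypothesis npure_inj : forall (A B : zmodType) (f : {additive A -> B}),
  C A -> C B -> npure N f -> injective f.

(** The apex [A] ranges over all groups: the proof of uniqueness amalgamates over a pushout, which
    may lie outside the class. *)
Hypothesis class_amalgam : forall (A B D : zmodType) (f : {additive A -> B})
    (g : {additive A -> D}), C B -> C D -> npure N f -> npure N g ->
  exists (E : zmodType) (h : {additive B -> E}) (k : {additive D -> E}),
    C E /\ nindep N f g h k.

(** Stated elementwise, this gives closure under the directed colimits formed below, whose legs are
    npure, injective and jointly surjective. *)
Hypothesis class_local : forall L : zmodType,
  (forall x : L, exists (A : zmodType) (f : {additive A -> L}),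
    [/\ C A, npure N f, injective f & exists a, f a = x]) -> C L.

Hypothesis class_pure : forall (A B : zmodType) (f : {additive A -> B}),
  C B -> injective f -> npure setT f -> C A.

Let K := ab_cat M C.

Definition map_of (A B : K) (f : hom A B) : {additive sval A -> sval B} := sval f.

Lemma map_of_npure (A B : K) (f : hom A B) : npure N (map_of f).
Proof. by apply/mor_npure; [exact: svalP A|exact: svalP B|exact: (svalP f)]. Qed.
Arguments map_of_npure {A B} f [n a b].

Lemma map_of_inj (A B : K) (f : hom A B) : injective (map_of f).
Proof. exact: (npure_inj (svalP A) (svalP B) (map_of_npure f)). Qed.

Lemma hom_exists (A B : K) (f : {additive sval A -> sval B}) :
  npure N f -> exists g : hom A B, map_of g = f.
Proof.
move=> fp; have Mf : M _ _ f by apply/mor_npure; [exact: svalP A|exact: svalP B|].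
by exists (exist _ f Mf).
Qed.

Lemma map_of_comp (A B D : K) (g : hom B D) (f : hom A B) x :
  map_of (g ∘ f) x = map_of g (map_of f x).
Proof. by []. Qed.

Lemma hom_eq (A B : K) (f g : hom A B) : map_of f =1 map_of g -> f = g.
Proof. exact: ab_hom_eq. Qed.

Lemma hom_eqP (A B : K) (f g : hom A B) x : f = g -> map_of f x = map_of g x.
Proof. by move=> ->. Qed.

Program Definition nindependence : independence K :=
  @Independence K (fun A B D E f g h k =>
    nindep N (map_of f) (map_of g) (map_of h) (map_of k)) _ _.
Next Obligation. by move=> A B D E f g h k [e _]; apply: hom_eq. Qed.
Next Obligation.
move=> A B D E F f g h k e hfkg; split=> -[_ i]; split=> [a|n b c x Nn].
- exact: (hom_eqP a (congr1 (cmp e) hfkg)).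
(* Since [e] is npure, an n-th root of the image in the larger group yields one in [D]'s place
   before applying [e]; the converse direction pushes roots forward. *)
- rewrite !map_of_comp -raddfD => /(map_of_npure e Nn)[y]; exact: i.
- exact: (hom_eqP a hfkg).
- move=> hk; apply: (i n b c (map_of e x) Nn).
  by rewrite !map_of_comp -raddfD hk raddfMn.
Qed.

(** For uniqueness, independence says that the pushout [Q] maps to both completions by npure maps;
    amalgamating [E1] and [E2] over [Q] then identifies the two cospans. *)
Lemma nindependence_weakly_stable : weakly_stable nindependence.
Proof.
split.
- by move=> A B D E f g h k; apply: nindep_sym.
- by move=> A B B' D E E' f f' g h h' k k'; apply: nindep_trans.
- move=> A B D D' E E' f g g' h h' k k' /nindep_sym i /nindep_sym i'.
  by apply/nindep_sym/nindep_trans; [exact: i|exact: i'].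
- move=> A B D f g.
  have [E [h [k [CE i]]]] := class_amalgam (svalP B) (svalP D)
    (map_of_npure f) (map_of_npure g).
  pose E' : K := exist _ E CE.
  have [h' hE] := @hom_exists B E' h (nindep_pure (map_of_npure g) i).
  have [k' kE] := @hom_exists D E' k (nindep_pure (map_of_npure f) (nindep_sym i)).
  by exists E', h', k'; rewrite /= hE kE.
move=> A B D E1 E2 f g h1 k1 h2 k2 i1 i2.
have [Q [h [k [hk_surj hk0]]]] := group_pushout (map_of f) (map_of g).
have desc (E : K) (h' : hom B E) (k' : hom D E) :
    nindep N (map_of f) (map_of g) (map_of h') (map_of k') ->
    exists p : {additive Q -> sval E}, [/\ npure N p,
      forall b, p (h b) = map_of h' b & forall c, p (k c) = map_of k' c].
  move=> [e i].
  have [y|y [b [c [hb <-]]]|y y' z z' [b [c [<- <-]]] [b' [c' [<- <-]]]|p pP] :=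
    @additive_of_rel Q (sval E) (fun y z => exists b c,
      h b + k c = y /\ map_of h' b + map_of k' c = z).
  - by have [b [c ->]] := hk_surj y; exists (map_of h' b + map_of k' c), b, c.
  - by have [a [-> ->]] := (hk0 b c).1 hb; rewrite e raddfN subrr.
  - by exists (b - b'), (c - c'); split; rewrite !raddfB opprD addrACA.
  have ph b : p (h b) = map_of h' b.
    by apply/pP; exists b, 0; rewrite !raddf0 !addr0.
  have pk c : p (k c) = map_of k' c.
    by apply/pP; exists 0, c; rewrite !raddf0 !add0r.
  exists p; split=> // n y d Nn; have [b [c ->]] := hk_surj y.
  rewrite raddfD ph pk => /(i n _ _ _ Nn)[b' [c' [a [-> ->]]]].
  exists (h b' + k c').
  have hkf : h (map_of f a) + k (- map_of g a) = 0 by apply/hk0; exists a.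
  by rewrite !raddfD /= addrACA hkf addr0 !raddfMn mulrnDl.
have [p1 [p1p p1h p1k]] := desc _ _ _ i1.
have [p2 [p2p p2h p2k]] := desc _ _ _ i2.
have [E [e1 [e2 [CE [e ei]]]]] := class_amalgam (svalP E1) (svalP E2) p1p p2p.
pose E' : K := exist _ E CE.
have [e1' e1E] := @hom_exists E1 E' e1 (nindep_pure p2p (conj e ei)).
have [e2' e2E] := @hom_exists E2 E' e2 (nindep_pure p1p (nindep_sym (conj e ei))).
exists E', e1', e2'; split; apply: hom_eq => x; rewrite !map_of_comp e1E e2E.
  by rewrite -p1h -p2h e.
by rewrite -p1k -p2k e.
Qed.

(** * Directed colimits of arrows and independent squares *)

Let H := nindependence_weakly_stable.
Let K2 := down_cat H.

Definition dom_map (X Y : K2) (s : hom X Y) := map_of (sq_dom s).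
Definition cod_map (X Y : K2) (s : hom X Y) := map_of (sq_cod s).
Definition arr_map (X : K2) := map_of (arr X).

Lemma dom_map_npure (X Y : K2) (s : hom X Y) : npure N (dom_map s).
Proof. exact: map_of_npure. Qed.

Lemma cod_map_npure (X Y : K2) (s : hom X Y) : npure N (cod_map s).
Proof. exact: map_of_npure. Qed.

Arguments dom_map_npure {X Y} s [n a b].
Arguments cod_map_npure {X Y} s [n a b].

Lemma dom_map_inj (X Y : K2) (s : hom X Y) : injective (dom_map s).
Proof. exact: map_of_inj. Qed.

Lemma cod_map_inj (X Y : K2) (s : hom X Y) : injective (cod_map s).
Proof. exact: map_of_inj. Qed.

Lemma dom_map_comp (X Y Z : K2) (t : hom Y Z) (s : hom X Y) x :
  dom_map (t ∘ s) x = dom_map t (dom_map s x).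
Proof. by []. Qed.

Lemma cod_map_comp (X Y Z : K2) (t : hom Y Z) (s : hom X Y) x :
  cod_map (t ∘ s) x = cod_map t (cod_map s x).
Proof. by []. Qed.

Lemma square_nindep (X Y : K2) (s : hom X Y) :
  nindep N (arr_map X) (dom_map s) (cod_map s) (arr_map Y).
Proof. exact: sq_indep s. Qed.

Lemma arr_dom_map (X Y : K2) (s : hom X Y) a :
  arr_map Y (dom_map s a) = cod_map s (arr_map X a).
Proof. by rewrite (square_nindep s).1. Qed.

Lemma arr_map_inj (X : K2) : injective (arr_map X).
Proof. exact: map_of_inj. Qed.

Lemma square_exists (X Y : K2) (u : {additive sval (dom X) -> sval (dom Y)})
    (v : {additive sval (cod X) -> sval (cod Y)}) :
  npure N u -> npure N v -> nindep N (arr_map X) u v (arr_map Y) ->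
  exists s : hom X Y, dom_map s = u /\ cod_map s = v.
Proof.
move=> /hom_exists[u' uE] /hom_exists[v' vE]; rewrite -uE -vE => i.
by exists (@Square K nindependence X Y u' v' i).
Qed.

Lemma square_hom_eq (X Y : K2) (s t : hom X Y) :
  dom_map s =1 dom_map t -> cod_map s =1 cod_map t -> s = t.
Proof. by move=> e e'; apply: square_eq; apply: hom_eq. Qed.

Lemma square_hom_inj (X Y Z : K2) (s : hom Y Z) (f g : hom X Y) :
  s ∘ f = s ∘ g -> f = g.
Proof.
move=> e; apply: square_hom_eq => x.
  by apply: (@dom_map_inj _ _ s); rewrite -!dom_map_comp e.
by apply: (@cod_map_inj _ _ s); rewrite -!cod_map_comp e.
Qed.

(** The comparison maps come from [group_colimit_map]. Purity and independence of the comparison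
    square each concern one element of the source, so they can be checked at a stage where it lives,
    using the leg of [c']. *)
Lemma surjective_cocone_is_colimit (P : poset) (D : diagram P K2) (c : cocone D) :
  (forall i j, exists k : P, ple i k /\ ple j k) ->
  (forall x, exists i y, dom_map (leg c i) y = x) ->
  (forall x, exists i y, cod_map (leg c i) y = x) -> is_colimit c.
Proof.
move=> dir ds cs c'.
have [u uE] : exists u : {additive sval (dom (vertex c)) -> sval (dom (vertex c'))},
    forall i x, u (dom_map (leg c i) x) = dom_map (leg c' i) x.
  apply: (@group_colimit_map P _ _ _ (fun i j ij => dom_map (dmap D ij))) => //.
  - by move=> i j ij x; rewrite -dom_map_comp leg_nat.
  - by move=> i j ij x; rewrite -dom_map_comp leg_nat.
  - by move=> i; apply: dom_map_inj.
have [v vE] : exists v : {additive sval (cod (vertex c)) -> sval (cod (vertex c'))},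
    forall i x, v (cod_map (leg c i) x) = cod_map (leg c' i) x.
  apply: (@group_colimit_map P _ _ _ (fun i j ij => cod_map (dmap D ij))) => //.
  - by move=> i j ij x; rewrite -cod_map_comp leg_nat.
  - by move=> i j ij x; rewrite -cod_map_comp leg_nat.
  - by move=> i; apply: cod_map_inj.
have up : npure N u.
  move=> n x b Nn; have [i [y <-]] := ds x; rewrite uE.
  move=> /(dom_map_npure _ Nn)[y' ->]; exists (dom_map (leg c i) y').
  by rewrite raddfMn.
have vp : npure N v.
  move=> n x b Nn; have [i [y <-]] := cs x; rewrite vE.
  move=> /(cod_map_npure _ Nn)[y' ->]; exists (cod_map (leg c i) y').
  by rewrite raddfMn.
have uv : nindep N (arr_map (vertex c)) u v (arr_map (vertex c')).
  split=> [x|n b a d Nn].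
    by have [i [y <-]] := ds x; rewrite arr_dom_map vE uE arr_dom_map.
  have [i [y <-]] := cs b; rewrite vE.
  move=> /((square_nindep (leg c' i)).2 _ _ _ _ Nn)[b' [a' [x [-> ->]]]].
  exists (cod_map (leg c i) b'), a', (dom_map (leg c i) x).
  by rewrite raddfD raddfMn uE arr_dom_map.
have [w [wu wv]] := square_exists up vp uv.
exists w; split=> [i|w' w'E].
  by apply: square_hom_eq => x; rewrite (dom_map_comp, cod_map_comp) ?wu ?wv.
apply: square_hom_eq => x.
  have [i [y <-]] := ds x; rewrite wu uE -(w'E i); exact: dom_map_comp.
have [i [y <-]] := cs x; rewrite wv vE -(w'E i); exact: cod_map_comp.
Qed.

(** Colimits are formed on the underlying groups. Each condition to be verified involves finitely
    many elements, which all come from one stage by directedness. *)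
Lemma colimit_exists (P : poset) (D : diagram P K2) :
  (forall i j, exists k : P, ple i k /\ ple j k) -> P ->
  exists c : cocone D, (forall x, exists i y, dom_map (leg c i) y = x) /\
    (forall x, exists i y, cod_map (leg c i) y = x).
Proof.
move=> dir i0.
have [A [la [laI lat las]]] := @group_colimit P (fun i => sval (dom (D i)))
  (fun i j ij => dom_map (dmap D ij)) dir i0
  (fun i ii x => congr1 (fun s => dom_map s x) (dmap1 D ii))
  (fun i j k ij jk ik x => congr1 (fun s => dom_map s x) (dmapM D ij jk ik))
  (fun i j ij => @dom_map_inj _ _ (dmap D ij)).
have [B [lb [lbI lbt lbs]]] := @group_colimit P (fun i => sval (cod (D i)))
  (fun i j ij => cod_map (dmap D ij)) dir i0
  (fun i ii x => congr1 (fun s => cod_map s x) (dmap1 D ii))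
  (fun i j k ij jk ik x => congr1 (fun s => cod_map s x) (dmapM D ij jk ik))
  (fun i j ij => @cod_map_inj _ _ (dmap D ij)).
have [f fE] : exists f : {additive A -> B},
    forall i x, f (la i x) = (lb i \o arr_map (D i)) x.
  apply: group_colimit_map lat _ laI _ => // [i j ij x|y].
    by rewrite /= arr_dom_map lbt.
  by have [i [x ->]] := las y; exists i, x.
have lap i : npure N (la i).
  move=> n x y Nn; have [j [z ->]] := las y; have [k [ik jk]] := dir i j.
  rewrite -(lat i k ik) -(lat j k jk) -raddfMn => /laI.
  exact: dom_map_npure.
have lbp i : npure N (lb i).
  move=> n x y Nn; have [j [z ->]] := lbs y; have [k [ik jk]] := dir i j.
  rewrite -(lbt i k ik) -(lbt j k jk) -raddfMn => /lbI.
  exact: cod_map_npure.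
have fp : npure N f.
  move=> n x y Nn; have [i [a ->]] := las x; have [j [b ->]] := lbs y.
  have [k [ik jk]] := dir i j.
  rewrite -(lat i k ik) -(lbt j k jk) fE /= -raddfMn => /lbI.
  move=> /(map_of_npure _ Nn)[a' ->]; exists (la k a'); exact: raddfMn.
have CA : C A.
  apply: class_local => x; have [i [a ->]] := las x.
  by exists (sval (dom (D i))), (la i); split=> //; [exact: svalP (dom (D i))|exists a].
have CB : C B.
  apply: class_local => x; have [i [a ->]] := lbs x.
  by exists (sval (cod (D i))), (lb i); split=> //; [exact: svalP (cod (D i))|exists a].
have [f' fE'] := @hom_exists (exist _ A CA) (exist _ B CB) f fp.
pose L : K2 := Arrow f'.
have ind i : nindep N (arr_map (D i)) (la i) (lb i) (arr_map L).
  rewrite /arr_map /= fE'; split=> [a|n b x y Nn]; first by rewrite fE.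
  have [j [a ->]] := las x; have [k [d ->]] := lbs y.
  have [m1 [im1 jm1]] := dir i j; have [m [m1m km]] := dir m1 k.
  have im := ple_trans im1 m1m; have jm := ple_trans jm1 m1m.
  rewrite -(lat j m jm) -(lbt k m km) -(lbt i m im) fE /= -raddfD -raddfMn.
  move=> /lbI /((square_nindep (dmap D im)).2 _ _ _ _ Nn)[b' [a' [a0 [-> ->]]]].
  exists b', (la m a'), a0; split=> //.
  by rewrite raddfB raddfMn lat.
have /all_sig[l lE] i :=
  cid (@square_exists (D i) L _ _ (lap i) (lbp i) (ind i)).
have ln i j (ij : ple i j) : l j ∘ dmap D ij = l i.
  apply: square_hom_eq => x; rewrite (dom_map_comp, cod_map_comp).
    by rewrite !(lE _).1 lat.
  by rewrite !(lE _).2 lbt.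
exists (Cocone ln); split=> /= x.
  by have [i [a ->]] := las x; exists i, a; rewrite (lE i).1.
by have [i [a ->]] := lbs x; exists i, a; rewrite (lE i).2.
Qed.

(** The two group maps lift separately because [t] is injective on both components; [nindep_cancel]
    makes the lifted square independent. *)
Lemma square_lift (X Y Z : K2) (t : hom Y X) (s : hom Z X) :
  (forall a, exists b, dom_map t b = dom_map s a) ->
  (forall a, exists b, cod_map t b = cod_map s a) ->
  exists r : hom Z Y, t ∘ r = s.
Proof.
move=> /(additive_lift (@dom_map_inj _ _ t))[u uE].
move=> /(additive_lift (@cod_map_inj _ _ t))[v vE].
have up : npure N u.
  move=> n a b Nn uab; apply: (dom_map_npure s Nn (b := dom_map t b)).
  by rewrite -uE uab raddfMn.
have vp : npure N v.
  move=> n a b Nn vab; apply: (cod_map_npure s Nn (b := cod_map t b)).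
  by rewrite -vE vab raddfMn.
have i : nindep N (arr_map Z) u v (arr_map Y).
  apply: (nindep_cancel (dom_map_npure t) (arr_dom_map t) _ uE vE).
    by move=> a; apply: (@cod_map_inj _ _ t); rewrite vE -!arr_dom_map uE.
  exact: square_nindep.
have [r [ru rv]] := square_exists up vp i.
exists r; apply: square_hom_eq => x.
  by rewrite dom_map_comp ru uE.
by rewrite cod_map_comp rv vE.
Qed.

(** * Accessibility at the first uncountable cardinal *)

Section Accessibility.
Variable l : small.
Hypothesis card_lt_l : forall T (A : set T), card_lt A [set: l] <-> countable A.

Let directed_countable (P : poset) : directed l P ->
  forall S : set P, countable S -> exists u, forall x, S x -> ple x u.
Proof. by move=> dir S /card_lt_l; apply: dir. Qed.

Let directed_nonempty (P : poset) : directed l P -> exists i : P, True.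
Proof.
by move=> /directed_countable /(_ set0 (countable0 _))[u _]; exists u.
Qed.

Let directed_pair (P : poset) : directed l P ->
  forall i j, exists k : P, ple i k /\ ple j k.
Proof.
move=> /directed_countable dir i j.
have [|k kP] := dir [set i; j]; first exact: finite_set_countable.
by exists k; split; apply: kP; [left|right].
Qed.

Lemma down_has_directed_colimits : has_directed_colimits l K2.
Proof.
move=> P D dir; have [i0 _] := directed_nonempty dir.
have [c [dc cc]] := colimit_exists D (directed_pair dir) i0.
by exists c; apply: surjective_cocone_is_colimit; first exact: directed_pair.
Qed.

Lemma countable_factor (X : K2) (e : nat -> sval (cod X)) (P : poset)
    (D : diagram P K2) (c : cocone D) :
  (forall y, exists n, e n = y) -> directed l P -> is_colimit c ->
  forall s : hom X (vertex c), exists i (t : hom X (D i)), s = leg c i ∘ t.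
Proof.
move=> es dir colim s; have [i0 _] := directed_nonempty dir.
(* The given colimit is compared with the concrete one, whose legs are known to be jointly
   surjective. *)
have [c0 [dc cc]] := colimit_exists D (directed_pair dir) i0.
have colim0 := surjective_cocone_is_colimit (directed_pair dir) dc cc.
have [w [wE _]] := colim c0; have [w' [w'E _]] := colim0 c.
have w'w : w' ∘ w = idm (vertex c).
  have [v [vE vu]] := colim c.
  rewrite -(vu (w' ∘ w)) => [|i]; last by rewrite -cmpA wE w'E.
  by apply: vu => i; rewrite cmp1m.
suff [i [t st]] : exists i (t : hom X (D i)), leg c0 i ∘ t = w ∘ s.
  exists i, t; rewrite -[s]cmp1m -w'w -cmpA -st cmpA w'E //.
move: (w ∘ s) => {}s.
(* The stage [ix n] captures the value at [e n] and, if [e n] has a preimage under the arrow, also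
   the value at that unique preimage. Countably many stages then have a common upper bound. *)
have /choice[ix ixP] n : exists i : P,
    (exists y, cod_map (leg c0 i) y = cod_map s (e n)) /\
    forall a, arr_map X a = e n -> exists y, dom_map (leg c0 i) y = dom_map s a.
  have [i [y yE]] := cc (cod_map s (e n)).
  have [[a ae]|na] := pselect (exists a, arr_map X a = e n); last first.
    by exists i; split=> [|a ae]; [exists y|case: na; exists a].
  have [j [z zE]] := dc (dom_map s a).
  have [k [ik jk]] := directed_pair dir i j.
  exists k; split=> [|a'].
    by exists (cod_map (dmap D ik) y); rewrite -cod_map_comp leg_nat.
  rewrite -ae => /arr_map_inj ->.
  by exists (dom_map (dmap D jk) z); rewrite -dom_map_comp leg_nat.
have [|k kP] := directed_countable dir (S := range ix).
  exact: sub_countable (card_image_le _ _) (countableP _).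
exists k; apply: square_lift => a.
  have [n en] := es (arr_map X a); have [_ /(_ a (esym en))[y <-]] := ixP n.
  have ik : ple (ix n) k by apply: kP; exists n.
  by exists (dom_map (dmap D ik) y); rewrite -dom_map_comp leg_nat.
have [n <-] := es a; have [[y <-] _] := ixP n.
have ik : ple (ix n) k by apply: kP; exists n.
by exists (cod_map (dmap D ik) y); rewrite -cod_map_comp leg_nat.
Qed.

(** Every map from [X] to the colimit factors through a stage. Two factorizations agree at any
    common later stage because the legs are left cancellable, so the induced function is well
    defined. *)
Lemma countable_presentable (X : K2) (e : nat -> sval (cod X)) :
  (forall y, exists n, e n = y) -> presentable l X.
Proof.
move=> es P D c dir colim c'.
have fac := countable_factor es dir colim.
have /choice[u uP] s : exists y, exists i (t : hom X (D i)),
    s = leg c i ∘ t /\ y = leg c' i t.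
  by have [i [t st]] := fac s; exists (leg c' i t), i, t.
have c'nat i j (ij : ple i j) (t : hom X (D i)) :
    leg c' i t = leg c' j (dmap D ij ∘ t).
  by rewrite -(leg_nat c' ij).
have uE i (t : hom X (D i)) : u (leg c i ∘ t) = leg c' i t.
  have [j [t' [e' ->]]] := uP (leg c i ∘ t).
  have [k [ik jk]] := directed_pair dir i j.
  rewrite (c'nat j k jk) (c'nat i k ik); congr (leg c' k _).
  by apply: (@square_hom_inj _ _ _ (leg c k)); rewrite !cmpA !leg_nat.
exists u; split=> [i|u' u'E]; first by apply/funext => t; exact: uE.
apply/funext => s; have [i [t ->]] := fac s.
by rewrite uE -u'E.
Qed.

Let coded (j : set (nat * nat * nat) * set nat) (X : K2) (e : nat -> sval (cod X)) :=
  (forall y, exists n, e n = y) /\ code (arr_map X) e = j.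

(** Indexing by codes instead of by arrows keeps the type of presentables small: it is a subtype of
    a type built from sets of natural numbers. *)
Let J : small := {j | exists (X : K2) (e : nat -> sval (cod X)), coded j e}.

(** The subobject cut out by [S] lies in the class by purity and has a code j. Replacing it by the
    isomorphic representative [G j] is needed because the objects of the diagram must literally be
    values of [G]. *)
Lemma good_coded (G : J -> K2) (X : K2) (S : set (sval (cod X))) :
  (forall j : J, exists e : nat -> sval (cod (G j)), coded (sval j) e) ->
  good (arr_map X) S ->
  exists j (s : hom (G j) X),
    (forall a, S (arr_map X a) <-> exists b, dom_map s b = a) /\
    (forall b, S b <-> exists a, cod_map s a = b).
Proof.
move=> GP gS; set f := arr_map X.
have [A0 [u0 [u0I u0S]]] := @subgroup_exists _ (fun a => S (f a))
  (eq_ind_r S (good0 gS) (raddf0 f))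
  (fun x y Sx Sy => eq_ind_r S (goodB gS Sx Sy) (raddfB f x y)).
have [B0 [v0 [v0I v0S]]] := subgroup_exists (good0 gS) (goodB gS).
have [a|f0 f0E] := additive_lift (f := f \o u0) v0I; first by apply/v0S/u0S; exists a.
have fp : npure N f by apply: map_of_npure.
have fI : injective f by apply: map_of_inj.
have u0p := good_dom_pure gS u0I u0S.
have CA0 : C A0 := class_pure (svalP (dom X)) u0I u0p.
have CB0 : C B0 := class_pure (svalP (cod X)) v0I (good_cod_pure gS v0I v0S).
have f0p : npure N f0.
  move=> n a b Nn fab; have [a' a'E] : exists a', u0 a = a' *+ n.
    by apply: (fp _ _ (v0 b) Nn); rewrite -raddfMn -fab f0E.
  exact: (u0p n a a' I).
have [f0' f0'E] := @hom_exists (exist _ A0 CA0) (exist _ B0 CB0) f0 f0p.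
pose X0 : K2 := Arrow f0'.
have [e eS] := (countable_range (good0 gS)).1 (good_countable gS).
have /choice[e0 e0E] n : exists b, v0 b = e n by apply/v0S/eS; exists n.
have e0s y : exists n, e0 n = y.
  have /eS[n en] : S (v0 y) by apply/v0S; exists y.
  by exists n; apply: v0I; rewrite e0E.
have X0P : exists (X : K2) (e' : nat -> sval (cod X)), coded (code f0 e0) e'.
  by exists X0, e0; split=> //; rewrite /arr_map /= f0'E.
pose j : J := exist _ _ X0P.
have [ej [ejs ejc]] := GP j.
have f0I : injective f0 by move=> x y /(congr1 v0); rewrite !f0E => /fI/u0I.
have [u1 [v1 [u1I v1I u1s v1s uv1]]] :=
  code_iso (@arr_map_inj (G j)) f0I ejs e0s ejc.
pose u : {additive _ -> _} := u0 \o u1; pose v : {additive _ -> _} := v0 \o v1.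
have uI : injective u by apply: inj_comp.
have vI : injective v by apply: inj_comp.
have fu a : f (u a) = v (arr_map (G j) a) by rewrite /= -uv1 f0E.
have uS a : S (f a) <-> exists b, u b = a.
  rewrite (u0S a); split=> [[b <-]|[b <-]]; last by exists (u1 b).
  by have [b' <-] := u1s b; exists b'.
have vS b : S b <-> exists a, v a = b.
  rewrite (v0S b); split=> [[a <-]|[a <-]]; last by exists (v1 a).
  by have [a' <-] := v1s a; exists a'.
have up : npure N u by move=> n a b _; apply: (good_dom_pure gS uI uS).
have vp : npure N v by move=> n a b _; apply: (good_cod_pure gS vI vS).
have [s [su sv]] := @square_exists (G j) X u v up vp (good_nindep gS fp vI fu uS vS).
by exists j, s; rewrite su sv.
Qed.

(** Each arrow [X] is the colimit of its good countable subobjects, ordered by inclusion. *)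
Lemma down_accessible_at : accessible_at l K2.
Proof.
split; first exact: down_has_directed_colimits.
have /choice[G GP] (j : J) : exists X : K2,
    exists e : nat -> sval (cod X), coded (sval j) e by exact: svalP j.
exists J, G; split=> [j|X].
  by have [e [es _]] := GP j; apply: (countable_presentable es).
pose PT : small := {S | good (arr_map X) S}.
have anti (S T : PT) : sval S `<=` sval T -> sval T `<=` sval S -> S = T.
  by case: S T => [S gS] [T gT] /= ST TS; apply: eq_exist; apply/seteqP.
pose P : poset := @Poset PT (fun S T => sval S `<=` sval T)
  (fun S => @subset_refl _ _) (fun S T U ST TU => subset_trans ST TU) anti.
have /choice[jx jxP] (S : P) := good_coded GP (svalP S).
have /all_sig[lg lgP] S := cid (jxP S).
have lift (S T : P) (ST : ple S T) :
    exists r : hom (G (jx S)) (G (jx T)), lg T ∘ r = lg S.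
  apply: square_lift => a.
    by apply/(lgP T).1/ST/(lgP S).1; exists a.
  by apply/(lgP T).2/ST/(lgP S).2; exists a.
(* The transition maps are chosen independently of each other; functoriality follows since the maps
   [lg S] into [X] are left cancellable. *)
pose m S T ST := projT1 (cid (lift S T ST)).
have mE S T ST : lg T ∘ m S T ST = lg S by exact: projT2 (cid (lift S T ST)).
have m1 S (SS : ple S S) : m S S SS = idm (G (jx S)).
  by apply: square_hom_inj (lg S) _ _ _; rewrite mE cmpm1.
have mM S T U (ST : ple S T) (TU : ple T U) (SU : ple S U) :
    m S U SU = m T U TU ∘ m S T ST.
  by apply: square_hom_inj (lg U) _ _ _; rewrite cmpA !mE.
pose D : diagram P K2 := Diagram m1 mM.
pose c : cocone D := @Cocone P K2 D X lg mE.
(* A countable union of good sets is countable, so [good_exists] encloses it in a good set. *)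
have dirP (F : set P) : countable F -> exists u : P, forall x, F x -> ple x u.
  move=> cF; have [|S gS FS] := @good_exists _ _ (arr_map X)
      (\bigcup_(S in F) sval S) (@arr_map_inj X).
    by apply: bigcup_countable => // S _; exact: good_countable (svalP S).
  by exists (exist _ S gS) => T FT x Tx; apply: FS; exists T.
have single x : exists S : P, sval S x.
  have [S gS xS] := good_exists (@arr_map_inj X) (countable1 x).
  by exists (exist _ S gS); apply: xS.
exists P, D, c; split=> //.
- by move=> F /card_lt_l; apply: dirP.
- by move=> S; exists (jx S).
apply: surjective_cocone_is_colimit => [S T|x|x].
- have [|U UP] := dirP [set S; T]; first exact: finite_set_countable.
  by exists U; split; apply: UP; [left|right].
- have [S Sx] := single (arr_map X x); exists S; exact/(lgP S).1.
- have [S Sx] := single x; exists S; exact/(lgP S).2.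
Qed.

End Accessibility.

Theorem class_has_stable_independence : has_stable_independence K.
Proof.
have [l lP] := aleph1_exists.
exists nindependence, nindependence_weakly_stable, l.
split; first exact: regular_of_countable.
exact: down_accessible_at.
Qed.

End StableClass.

(** * The classes *)

(** For the pushout itself the comparison map is the identity, which is npure for every [N]. *)
Lemma pushout_nindep (N : set nat) (A B D E : zmodType) (f : {additive A -> B})
    (g : {additive A -> D}) (h : {additive B -> E}) (k : {additive D -> E}) :
  (forall y, exists b d, y = h b + k d) ->
  (forall b d, h b + k d = 0 <-> exists a, b = f a /\ d = - g a) ->
  nindep N f g h k.
Proof.
move=> hk_surj hk0; split=> [a|n b d y _ hbkd].
  by apply/eqP; rewrite -subr_eq0 -raddfN; apply/eqP/hk0; exists a.
have [b' [d' yE]] := hk_surj y.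
have /hk0[a [ba da]] : h (b - b' *+ n) + k (d - d' *+ n) = 0.
  by rewrite !raddfB addrACA hbkd -opprD !raddfMn -mulrnDl yE subrr.
by exists b', d', a; rewrite -ba -da addrC subrK addrC subrK.
Qed.

Lemma npure0P (A B : zmodType) (f : {additive A -> B}) :
  injective f <-> npure [set 0%N] f.
Proof.
split=> [fI _ a b -> /= fa|fp]; first by exists a; apply: fI; rewrite fa !mulr0n raddf0.
apply: raddf_inj => a fa; have [//|a' ->] := fp 0%N a 0 erefl; exact: mulr0n.
Qed.

Lemma npureTP (A B : zmodType) (f : {additive A -> B}) :
  injective f /\ pure f <-> npure setT f.
Proof.
split=> [[fI fp] n a b _ fa|fp].
  have [|a' a'E] := fp n a; first by exists b.
  by exists a'; apply: fI; rewrite raddfMn a'E.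
split; first by apply/npure0P => n a b _; apply: fp.
by move=> n a [b /esym /(fp n _ _ I)[a' ->]]; exists a'; rewrite raddfMn.
Qed.

(** When [N] contains 0, npure maps are injective, and the pushout serves as the amalgam. This
    handles every category except that of reduced torsion-free groups. *)
Lemma pushout_class_stable (M : mor_class) (C : zmodType -> Prop) (N : set nat) :
  (forall (A B : zmodType) (f : {additive A -> B}), M A B f <-> npure N f) ->
  N 0%N ->
  (forall (A B D E : zmodType) (f : {additive A -> B}) (g : {additive A -> D})
      (h : {additive B -> E}) (k : {additive D -> E}),
    C B -> C D -> npure N f -> npure N g ->
    (forall y, exists b d, y = h b + k d) ->
    (forall b d, h b + k d = 0 <-> exists a, b = f a /\ d = - g a) -> C E) ->
  (forall L : zmodType,
    (forall x : L, exists (A : zmodType) (f : {additive A -> L}),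
      [/\ C A, injective f & exists a, f a = x]) -> C L) ->
  (forall (A B : zmodType) (f : {additive A -> B}),
    C B -> injective f -> npure setT f -> C A) ->
  has_stable_independence (ab_cat M C).
Proof.
move=> MN N0 Cpush Cloc Cpure; apply: class_has_stable_independence Cpure => //.
- by move=> A B f _ _ fp; apply/npure0P => _ a b ->; apply: fp.
- move=> A B D f g CB CD fp gp; have [E [h [k [hs hk]]]] := group_pushout f g.
  by exists E, h, k; split; [exact: Cpush hs hk|exact: pushout_nindep].
- move=> L LP; apply: Cloc => x; have [A [f [CA _ fI fx]]] := LP x.
  by exists A, f.
Qed.

Lemma any_group_stable : has_stable_independence (ab_cat mono any_group) /\
  has_stable_independence (ab_cat pure_mono any_group).
Proof.
by split; [apply: (pushout_class_stable (M := mono) npure0P)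
  |apply: (pushout_class_stable (M := pure_mono) npureTP)].
Qed.

(* Covers torsion groups (T the positive integers) and p-groups (T the powers
   of p). *)
Lemma annihilated_stable (T : set nat) (C := fun A : zmodType =>
    forall x : A, exists2 n, T n & x *+ n = 0) :
  (forall m n, T m -> T n -> T (m * n)%N) ->
  has_stable_independence (ab_cat mono C) /\
  has_stable_independence (ab_cat pure_mono C).
Proof.
move=> TM.
have push (A B D E : zmodType) (f : {additive A -> B}) (g : {additive A -> D})
    (h : {additive B -> E}) (k : {additive D -> E}) (N : set nat) :
    C B -> C D -> npure N f -> npure N g ->
    (forall y, exists b d, y = h b + k d) ->
    (forall b d, h b + k d = 0 <-> exists a, b = f a /\ d = - g a) -> C E.
  move=> CB CD _ _ hs _ y; have [b [d ->]] := hs y.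
  have [m Tm bm] := CB b; have [n Tn dn] := CD d.
  exists (m * n)%N; first exact: TM.
  rewrite mulrnDl -!raddfMn mulrnA bm mul0rn.
  by rewrite mulnC mulrnA dn mul0rn !raddf0 addr0.
have loc (L : zmodType) :
    (forall x : L, exists (A : zmodType) (f : {additive A -> L}),
      [/\ C A, injective f & exists a, f a = x]) -> C L.
  move=> LP x; have [A [f [CA _ [a <-]]]] := LP x; have [n Tn an] := CA a.
  by exists n => //; rewrite -raddfMn an raddf0.
have sub (A B : zmodType) (f : {additive A -> B}) :
    C B -> injective f -> npure setT f -> C A.
  move=> CB fI _ a; have [n Tn an] := CB (f a).
  by exists n => //; apply: fI; rewrite raddfMn an raddf0.
split.
  by apply: (pushout_class_stable (M := mono) npure0P _ _ loc sub) => //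
    A B D E f g h k; exact: push.
by apply: (pushout_class_stable (M := pure_mono) npureTP _ _ loc sub) => //
    A B D E f g h k; exact: push.
Qed.

Definition positive : set nat := [set n | 0 < n]%N.

Lemma torsion_stable : has_stable_independence (ab_cat mono torsion) /\
  has_stable_independence (ab_cat pure_mono torsion).
Proof.
apply: (@annihilated_stable positive) => m n m0 n0.
by rewrite /positive /= muln_gt0 m0.
Qed.

Lemma p_group_stable (p : nat) : has_stable_independence (ab_cat mono (p_group p)) /\
  has_stable_independence (ab_cat pure_mono (p_group p)).
Proof.
have -> : p_group p =
    fun A : zmodType => forall x : A, exists2 n, range (expn p) n & x *+ n = 0.
  apply/funext => A; apply/propext; split=> AP x; have := AP x.
    by move=> [n xn]; exists (p ^ n)%N => //; exists n.
  by move=> [_ [n _ <-] xn]; exists n.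
apply: annihilated_stable => _ _ [m _ <-] [n _ <-].
by exists (m + n)%N; rewrite ?expnD.
Qed.

Lemma divisible_stable : has_stable_independence (ab_cat mono divisible).
Proof.
apply: (pushout_class_stable (M := mono) npure0P) => //.
- move=> A B D E f g h k CB CD _ _ hs _ n y n0 _; have [b [d ->]] := hs y.
  have [b' _ <-] := CB n b n0 isT; have [d' _ <-] := CD n d n0 isT.
  by exists (h b' + k d') => //; rewrite mulrnDl !raddfMn.
- move=> L LP n x n0 _; have [A [f [CA _ [a <-]]]] := LP x.
  by have [a' _ <-] := CA n a n0 isT; exists (f a') => //; rewrite raddfMn.
(* A pure subgroup of a divisible group is divisible. *)
- move=> A B f CB fI fp n a n0 _; have [b _ fa] := CB n (f a) n0 isT.
  by have [a' ->] := fp n a b I (esym fa); exists a'.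
Qed.

(** * Torsion-free and reduced torsion-free groups *)

Lemma torsion_free_pushout (N : set nat) (A B D E : zmodType)
    (f : {additive A -> B}) (g : {additive A -> D})
    (h : {additive B -> E}) (k : {additive D -> E}) :
  (forall n, (0 < n)%N -> N n) ->
  torsion_free B -> torsion_free D -> npure N f ->
  (forall y, exists b d, y = h b + k d) ->
  (forall b d, h b + k d = 0 <-> exists a, b = f a /\ d = - g a) ->
  torsion_free E.
Proof.
move=> N0 tB tD fp hs hk n y n0; have [b [d ->]] := hs y.
rewrite mulrnDl -!raddfMn => /hk[a [bn dn]].
(* From n b = f a and n d = - g a, purity of [f] gives a = n a'. Torsion-freeness then cancels n, so
   (b, d) is already a relation of the pushout. *)
have [a' aE] := fp n a b (N0 n n0) (esym bn).
apply/hk; exists a'; split; apply/eqP.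
  rewrite -subr_eq0; apply/eqP/(tB n) => //.
  by rewrite mulrnBl bn aE raddfMn subrr.
rewrite -subr_eq0 opprK; apply/eqP/(tD n) => //.
by rewrite mulrnDl dn aE raddfMn addNr.
Qed.

Lemma torsion_free_local (L : zmodType) :
  (forall x : L, exists (A : zmodType) (f : {additive A -> L}),
    [/\ torsion_free A, injective f & exists a, f a = x]) -> torsion_free L.
Proof.
move=> LP n x n0; have [A [f [tA fI [a <-]]]] := LP x.
rewrite -raddfMn -(raddf0 f) => /fI an; congr (f _); exact: tA an.
Qed.

Lemma torsion_free_sub (A B : zmodType) (f : {additive A -> B}) :
  torsion_free B -> injective f -> torsion_free A.
Proof.
move=> tB fI n a n0 an; apply: fI; rewrite raddf0.
by apply: (tB n) => //; rewrite -raddfMn an raddf0.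
Qed.

Lemma torsion_free_stable :
  has_stable_independence (ab_cat pure_mono torsion_free).
Proof.
apply: (pushout_class_stable (M := pure_mono) npureTP) => //.
- move=> A B D E f g h k tB tD fp _; exact: (torsion_free_pushout (N := setT)).
- exact: torsion_free_local.
- by move=> A B f tB fI _; apply: torsion_free_sub fI.
Qed.

(** The elements of the first Ulm subgroup; in a torsion-free group this is the largest divisible
    subgroup. *)
Definition infinitely_divisible (A : zmodType) (x : A) : Prop :=
  forall n, (0 < n)%N -> exists y, x = y *+ n.

Lemma infinitely_divisible0 (A : zmodType) : infinitely_divisible (0 : A).
Proof. by move=> n _; exists 0; rewrite mul0rn. Qed.

Lemma infinitely_divisibleB (A : zmodType) (x y : A) :
  infinitely_divisible x -> infinitely_divisible y -> infinitely_divisible (x - y).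
Proof.
move=> xd yd n n0; have [x' ->] := xd n n0; have [y' ->] := yd n n0.
by exists (x' - y'); rewrite mulrnBl.
Qed.

(** Roots are unique in a torsion-free group, so the n-th root of x is m times any mn-th root of
    x. *)
Lemma infinitely_divisible_root (A : zmodType) (x : A) (n : nat) :
  torsion_free A -> (0 < n)%N -> infinitely_divisible x ->
  exists2 y, infinitely_divisible y & x = y *+ n.
Proof.
move=> tA n0 xd; have [y xy] := xd n n0; exists y => // m m0.
have [|z xz] := xd (m * n)%N; first by rewrite muln_gt0 m0.
exists z; apply/eqP; rewrite -subr_eq0; apply/eqP/(tA n) => //.
by rewrite mulrnBl -mulrnA -xy -xz subrr.
Qed.

Lemma reduced_torsion_freeP (A : zmodType) : torsion_free A ->
  reduced A <-> forall x : A, infinitely_divisible x -> x = 0.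
Proof.
move=> tA; split=> [rA x xd|dA S _ Sd x Sx].
  apply: (rA [pred x | `[< infinitely_divisible x >]]); last exact/asboolP.
    split=> [|y z /asboolP yd /asboolP zd]; apply/asboolP.
      exact: infinitely_divisible0.
    exact: infinitely_divisibleB.
  move=> n y n0 /asboolP /(infinitely_divisible_root tA n0)[z zd ->].
  by exists z => //; apply/asboolP.
by apply: dA => n n0; have [y _ <-] := Sd n x n0 Sx; exists y.
Qed.

(** The quotient by the divisible part. If r x = n r z, then x - n z lies in the divisible kernel
    and has an n-th root, so x has one too. The quotient map need not be injective, whence the
    restriction to positive n. *)
Lemma reduced_reflection (Q : zmodType) : torsion_free Q ->
  exists (R : zmodType) (r : {additive Q -> R}),
    [/\ reduced R, torsion_free R & npure positive r].
Proof.
move=> tQ.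
have [R [r [rs r0]]] :=
  quotient_exists (@infinitely_divisible0 Q) (@infinitely_divisibleB Q).
have rp : npure positive r.
  move=> n x y n0; have [z <-] := rs y; rewrite -raddfMn => /eqP.
  rewrite -subr_eq0 -raddfB => /eqP/r0 /(infinitely_divisible_root tQ n0)[w _ xz].
  by exists (w + z); rewrite mulrnDl -xz subrK.
have tR : torsion_free R.
  move=> n y n0; have [x <-] := rs y; rewrite -raddfMn.
  move=> /r0 /(infinitely_divisible_root tQ n0)[z zd xz].
  rewrite (_ : x = z); first exact/r0.
  by apply/eqP; rewrite -subr_eq0; apply/eqP/(tQ n) => //; rewrite mulrnBl xz subrr.
exists R, r; split=> //; apply/reduced_torsion_freeP => // y.
have [x <-] := rs y => xd; apply/r0 => n n0; have [z xz] := xd n n0.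
exact: rp n0 xz.
Qed.

Lemma reduced_torsion_free_stable :
  has_stable_independence
    (ab_cat pure_mono (fun A => reduced A /\ torsion_free A)).
Proof.
(* A kernel element maps to 0, which is divisible by every n; by purity it is infinitely divisible,
   hence 0 in a reduced torsion-free group. *)
have inj (A B : zmodType) (f : {additive A -> B}) :
    reduced A /\ torsion_free A -> npure positive f -> injective f.
  move=> [rA tA] fp; apply: raddf_inj => a fa; apply: (reduced_torsion_freeP tA).1 => //.
  by move=> n n0; apply: (fp n a 0 n0); rewrite fa mul0rn.
apply: (@class_has_stable_independence _ _ positive).
- move=> A B f rtA _; split=> [/npureTP fp n a b _|fp]; first exact: fp.
  split; first exact: inj.
  move=> n a [b /esym fa]; have [n0|n0] := posnP n; last first.
    by have [a' ->] := fp n a b n0 fa; exists a'; rewrite raddfMn.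
  by exists a; rewrite fa n0.
- by move=> A B f rtA _; apply: inj.
- move=> A B D f g [rB tB] [rD tD] fp gp.
  have [Q [h [k [hs hk]]]] := group_pushout f g.
  have tQ := torsion_free_pushout (fun n n0 => n0) tB tD fp hs hk.
  have [e i] := pushout_nindep positive hs hk.
  have [R [r [rR tR rp]]] := reduced_reflection tQ.
  (* The reduced quotient of the pushout is the amalgam; independence survives because [r] is npure
     for positive n. *)
  exists R, (r \o h), (r \o k); split=> //; split=> [a|n b d y n0] /=.
    by rewrite e.
  by rewrite -raddfD => /(rp n _ _ n0)[z]; exact: i.
- move=> L LP; have tL : torsion_free L.
    apply: torsion_free_local => x; have [A [f [[_ tA] _ fI fx]]] := LP x.
    by exists A, f.
  split=> //; apply/reduced_torsion_freeP => // x.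
  have [A [f [[rA tA] fp fI [a <-]]]] := LP x => fd.
  rewrite (_ : a = 0) ?raddf0 //; apply: (reduced_torsion_freeP tA).1 => // n n0.
  by have [y fy] := fd n n0; apply: fp n0 fy.
- move=> A B f [rB tB] fI _; have tA := torsion_free_sub tB fI.
  split=> //; apply/reduced_torsion_freeP => // a ad.
  apply: fI; rewrite raddf0; apply: (reduced_torsion_freeP tB).1 => // n n0.
  by have [a' ->] := ad n n0; exists (f a'); rewrite raddfMn.
Qed.

Theorem theorem3p9 :
  (has_stable_independence (ab_cat mono any_group) /\
   has_stable_independence (ab_cat pure_mono any_group)) /\
  (has_stable_independence (ab_cat pure_mono torsion_free) /\
   has_stable_independence
     (ab_cat pure_mono (fun A => reduced A /\ torsion_free A))) /\
  (forall p : nat, prime p ->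
     has_stable_independence (ab_cat mono (p_group p)) /\
     has_stable_independence (ab_cat pure_mono (p_group p))) /\
  (has_stable_independence (ab_cat mono torsion) /\
   has_stable_independence (ab_cat pure_mono torsion)) /\
  has_stable_independence (ab_cat mono divisible).
Proof.
split; first exact: any_group_stable.
split; first by split; [exact: torsion_free_stable|exact: reduced_torsion_free_stable].
split; first by move=> p _; exact: p_group_stable.
by split; [exact: torsion_stable|exact: divisible_stable].
Qed.
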